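(* There is an algorithm that, given an integer $n\ge 0$, explicitly constructs in $\mathcal{O}(n^2)$ operations the eigendecomposition $M^n=Q^n\Lambda^n(Q^n)^T$ of the Bernstein mass matrix $M^n$, where $\Lambda^n=\operatorname{diag}(\lambda^n_0,\lambda^n_1,\dots,\lambda^n_n)$ and $Q^n$ is the $(n+1)\times(n+1)$ orthogonal matrix whose $k$-th column, $0\le k\le n$, is $\sqrt{(2k+1)\lambda^n_k}\;E^{k,n}\mathbf{\Pi}(L^k)$.
   Context: Matrix and vector indices start at $0$. Operations are exact real arithmetic operations (additions, subtractions, multiplications, divisions) and square roots. The Bernstein polynomials are $B^n_i(x)=\binom{n}{i}x^i(1-x)^{n-i}$, $0\le i\le n$, and $M^n$ is the $(n+1)\times(n+1)$ matrix $M^n_{ij}=\int_0^1 B^n_i(x)B^n_j(x)\,dx$. For $0\le i\le n$, $\lambda^n_i=\frac{(n!)^2}{(n+i+1)!\,(n-i)!}$. $L^k$ is the Legendre polynomial of degree $k$ mapped to $[0,1]$ (orthogonal in $L^2(0,1)$ to all polynomials of degree less than $k$), scaled so that $L^k(1)=1$. $\mathbf{\Pi}(L^k)\in\mathbb{R}^{k+1}$ is the vector of coefficients of $L^k$ in the Bernstein basis $\{B^k_i\}_{i=0}^k$. For $m\le n$, $E^{m,n}$ is the $(n+1)\times(m+1)$ matrix with entries $E^{m,n}_{ij}=\binom{m}{j}\binom{n-m}{i-j}/\binom{n}{i}$ (with $\binom{a}{b}=0$ for $b<0$ or $b>a$), which maps the degree-$m$ Bernstein coefficients of a polynomial to its degree-$n$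 Bernstein coefficients. *)

(* Defs.v *)
From HB Require Import structures.
From mathcomp Require Import all_boot all_order all_algebra.
From mathcomp Require Import all_classical all_reals all_analysis.
Import Order.TTheory GRing.Theory Num.Theory.
Import numFieldNormedType.Exports.

Set Implicit Arguments.
Unset Strict Implicit.
Unset Printing Implicit Defensive.

Local Open Scope classical_set_scope.
Local Open Scope ring_scope.

Section Bernstein.
Variable R : realType.

Definition L2dot (p q : {poly R}) : R :=
  \int[@lebesgue_measure R]_(x in `[0%R, 1%R]) (p.[x] * q.[x]).

Definition bernstein (n i : nat) : {poly R} :=
  'C(n, i)%:R *: ('X^i * (1 - 'X) ^+ (n - i)).

Definition mass_mx (n : nat) : 'M[R]_n.+1 :=
  \matrix_(i < n.+1, j < n.+1) L2dot (bernstein n i) (bernstein n j).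

Definition mass_eig (n i : nat) : R :=
  (n`! ^ 2)%:R / ((n + i + 1)`! * (n - i)`!)%:R.

Definition mass_eig_mx (n : nat) : 'M[R]_n.+1 :=
  diag_mx (\row_(i < n.+1) mass_eig n i).

Definition is_shifted_legendre (k : nat) (p : {poly R}) : Prop :=
  [/\ size p = k.+1,
      forall q : {poly R}, (size q <= k)%N -> L2dot p q = 0
    & p.[1] = 1].

(* The polynomial determined by the three conditions above; [xget] would return
   the default value 0 only if there were none. *)
Definition legendre (k : nat) : {poly R} :=
  xget 0 [set p | is_shifted_legendre k p].

(* The vector of coefficients of p in the basis (bernstein m i)_i; the default
   value 0 is returned only when p has degree larger than m. *)
Definition bernstein_coef (m : nat) (p : {poly R}) : 'cV[R]_m.+1 :=
  xget 0 [set c : 'cV[R]_m.+1 | p = \sum_(i < m.+1) c i 0 *: bernstein m i].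

(* The test j <= i is needed because subtraction is truncated: the binomial
   coefficient is 0 when i - j is negative. *)
Definition elevation_mx (m n : nat) : 'M[R]_(n.+1, m.+1) :=
  \matrix_(i < n.+1, j < m.+1)
    if (j <= i)%N then ('C(m, j) * 'C(n - m, i - j))%:R / 'C(n, i)%:R else 0.

Definition mass_eigvec_mx (n : nat) : 'M[R]_n.+1 :=
  \matrix_(i < n.+1, k < n.+1)
    (Num.sqrt ((2 * k + 1)%:R * mass_eig n k) *:
       (elevation_mx k n *m bernstein_coef k (legendre k))) i 0.

Definition orthogonal_mx (n : nat) (Q : 'M[R]_n) : Prop :=
  Q^T *m Q = 1%:M /\ Q *m Q^T = 1%:M.

End Bernstein.

(* Algorithms are programs of a real-number RAM, presented as a WHILE language.
   A state has natural-number variables, used for indexing and control flow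
   only, and two-dimensional arrays of real numbers. Program text contains no
   real constants other than natural literals, and index values cannot be
   converted to real numbers: every real number that depends on the input has
   to be produced by counted operations. *)

Inductive iexp : Type :=
| IVar of nat
| ILit of nat
| IAdd of iexp & iexp
| ISub of iexp & iexp
| IMul of iexp & iexp.

Inductive rexp : Type :=
| RLit of nat
| RCell of nat & iexp & iexp
| RAdd of rexp & rexp
| RSub of rexp & rexp
| RMul of rexp & rexp
| RDiv of rexp & rexp
| RSqrt of rexp.

(* The guard (e1, e2) of [If] and [While] is the test e1 < e2 on indices. *)
Inductive cmd : Type :=
| Skip
| Seq of cmd & cmd
| ISet of nat & iexp
| RSet of nat & iexp & iexp & rexp
| If of iexp * iexp & cmd & cmd
| While of iexp * iexp & cmd.

Record state (R : Type) : Type := State {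
  ivar : nat -> nat;
  cell : nat -> nat -> nat -> R }.

Section Semantics.
Variable R : realType.
Implicit Types s : state R.

Fixpoint ieval s (e : iexp) : nat :=
  match e with
  | IVar x => ivar s x
  | ILit c => c
  | IAdd e1 e2 => (ieval s e1 + ieval s e2)%N
  | ISub e1 e2 => (ieval s e1 - ieval s e2)%N
  | IMul e1 e2 => (ieval s e1 * ieval s e2)%N
  end.

Definition test s (b : iexp * iexp) : bool := (ieval s b.1 < ieval s b.2)%N.

Fixpoint reval s (r : rexp) : R :=
  match r with
  | RLit c => c%:R
  | RCell a e1 e2 => cell s a (ieval s e1) (ieval s e2)
  | RAdd r1 r2 => reval s r1 + reval s r2
  | RSub r1 r2 => reval s r1 - reval s r2
  | RMul r1 r2 => reval s r1 * reval s r2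
  | RDiv r1 r2 => reval s r1 / reval s r2
  | RSqrt r1 => Num.sqrt (reval s r1)
  end.

(* No division by zero and no square root of a negative number. *)
Fixpoint rsafe s (r : rexp) : bool :=
  match r with
  | RLit _ | RCell _ _ _ => true
  | RAdd r1 r2 | RSub r1 r2 | RMul r1 r2 => rsafe s r1 && rsafe s r2
  | RDiv r1 r2 => [&& rsafe s r1, rsafe s r2 & reval s r2 != 0]
  | RSqrt r1 => rsafe s r1 && (0 <= reval s r1)
  end.

Fixpoint rcost (r : rexp) : nat :=
  match r with
  | RLit _ | RCell _ _ _ => 0
  | RAdd r1 r2 | RSub r1 r2 | RMul r1 r2 | RDiv r1 r2 =>
      (rcost r1 + rcost r2).+1
  | RSqrt r1 => (rcost r1).+1
  end.

Definition set_ivar s (x v : nat) : state R :=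
  State (fun y => if y == x then v else ivar s y) (cell s).

Definition set_cell s (a i j : nat) (v : R) : state R :=
  State (ivar s)
    (fun b k l => if [&& b == a, k == i & l == j] then v else cell s b k l).

(* [exec c s t s']: started in s, the program c terminates in s' after exactly
   t arithmetic operations and square roots. *)
Inductive exec : cmd -> state R -> nat -> state R -> Prop :=
| exec_Skip s : exec Skip s 0 s
| exec_Seq c1 c2 s1 s2 s3 t1 t2 :
    exec c1 s1 t1 s2 -> exec c2 s2 t2 s3 -> exec (Seq c1 c2) s1 (t1 + t2) s3
| exec_ISet x e s : exec (ISet x e) s 0 (set_ivar s x (ieval s e))
| exec_RSet a e1 e2 r s :
    rsafe s r ->
    exec (RSet a e1 e2 r) s (rcost r)
      (set_cell s a (ieval s e1) (ieval s e2) (reval s r))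
| exec_If b c1 c2 s t s' :
    exec (if test s b then c1 else c2) s t s' -> exec (If b c1 c2) s t s'
| exec_WhileF b c s : ~~ test s b -> exec (While b c) s 0 s
| exec_WhileT b c s1 s2 s3 t1 t2 :
    test s1 b -> exec c s1 t1 s2 -> exec (While b c) s2 t2 s3 ->
    exec (While b c) s1 (t1 + t2) s3.

(* The input is the value of variable 0; everything else is initially 0. *)
Definition init_state (n : nat) : state R :=
  State (fun x => if x == 0%N then n else 0%N) (fun _ _ _ => 0).

Definition array_mx (n : nat) (s : state R) (a : nat) : 'M[R]_n :=
  \matrix_(i < n, j < n) cell s a i j.

End Semantics.

(* Main.v *)
Require Import Defs.
From HB Require Import structures.
From mathcomp Require Import all_boot all_order all_algebra.
From mathcomp Require Import all_classical all_reals all_analysis.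
From mathcomp Require Import ring lra zify.
Import Order.TTheory GRing.Theory Num.Theory.
Import numFieldNormedType.Exports.
Local Open Scope classical_set_scope.
Local Open Scope ring_scope.
Set Implicit Arguments.
Unset Strict Implicit.
Unset Printing Implicit Defensive.

(** The three-term recurrence in the degree k makes all the entries computable
in constant time each, and the same recurrence proves the eigendecomposition.

Write L_k for the Legendre polynomials on the unit interval, B_i for the
Bernstein basis of degree n, u = 2x - 1 and v = x (1 - x). Besides Bonnet's
recurrence, the L_k satisfy the ladder identity
[(2 k + 1) 2 v L_k' = k (k + 1) (L_(k-1) - L_(k+1))] (lemma [leg_ladder]),
while [v B_i' = (i - n x) B_i] (lemma [bernstein_ladder]). The second identity
says that multiplying the i-th Bernstein coefficient of p by 2 i - n yields
[2 v p' + n u p] (lemma [coef_index_ladder]), and, after an integration by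
parts, that multiplying the i-th moment of p, the integral of B_i p, by 2 i - n
amounts to replacing p by [(n + 2) u p - 2 v p'] (lemma
[bernstein_index_by_parts]). For p = L_k both
expressions are combinations of L_(k-1) and L_(k+1), with different
coefficients. The ratio of these coefficients is accounted for by the
eigenvalues, so by induction on k the operator that sends p to the polynomial
whose Bernstein coefficients are the moments of p maps L_k to a multiple of L_k,
the factor being the k-th eigenvalue (lemma [durrmeyer_leg]). On coefficient
vectors, this operator is the mass matrix.

For k = n + 1 the factor is 0, hence L_(n+1) has vanishing moments against all
the B_i and is orthogonal to all polynomials of degree at most n (lemma
[leg_orthogonal]). Its norm follows from Bonnet's recurrence. These facts
identify the L_k with the polynomials characterized by orthogonality (lemma
[legendreE]), and give the orthogonality of the eigenvector matrix.

The program tabulates the moments of the L_k by the recurrence [momentS], whose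
leading coefficient (k + 1) (n + k + 2) never vanishes, and the eigenvalues by
their ratios; a moment divided by the eigenvalue is a Bernstein coefficient of
L_k (lemma [moment_leg_coef]). Each entry costs a bounded number of operations.
*)

(** * Integration of polynomials over the unit interval *)

Section Integral.
Variable R : realType.
Implicit Types p q : {poly R}.

Definition int01 p : R := \int[@lebesgue_measure R]_(x in `[0%R, 1%R]) p.[x].

Lemma L2dotE p q : L2dot p q = int01 (p * q).
Proof. by apply: eq_Rintegral => x _; rewrite hornerM. Qed.

Lemma int01_deriv p : int01 p^`() = p.[1] - p.[0].
Proof.
rewrite /int01 /Rintegral (@continuous_FTC2 _ _ (horner p)) //.
- by apply: continuous_subspaceT; exact: continuous_horner.
- split=> [x _| |]; first exact: derivable_horner.
  + by apply: cvg_at_right_filter; exact: continuous_horner.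
  + by apply: cvg_at_left_filter; exact: continuous_horner.
- by move=> x _; rewrite -derivE.
Qed.

Lemma antiderivative p : exists q, q^`() = p.
Proof.
exists (\poly_(i < (size p).+1) (p`_i.-1 / i%:R)).
apply/polyP => i; rewrite coef_deriv coef_poly ltnS /=.
case: ltnP => [_|sp]; last by rewrite mul0rn nth_default.
by rewrite -[_ *+ _]mulr_natr mulfVK // pnatr_eq0.
Qed.

(** Integrating through antiderivatives gives linearity without any
integrability argument. *)
Lemma int01_is_linear : scalar int01.
Proof.
move=> a p q; have [P <-] := antiderivative p; have [Q <-] := antiderivative q.
by rewrite -derivZ -derivD !int01_deriv !hornerE /=; ring.
Qed.

HB.instance Definition _ :=
  GRing.isLinear.Build R {poly R} R _ int01 int01_is_linear.

Lemma int01Z a p : int01 (a *: p) = a * int01 p.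
Proof. exact: linearZ. Qed.

Lemma int01_natl k p : int01 (k%:R * p) = k%:R * int01 p.
Proof. by rewrite mulr_natl raddfMn mulr_natl. Qed.

End Integral.

(** * Legendre polynomials from Bonnet recurrence *)

Section Legendre.
Variable R : realType.

Let u : {poly R} := 'X *+ 2 - 1.
Let v : {poly R} := 'X * (1 - 'X).

(** Bonnet recurrence, with the normalization of value 1 at 1; [u] is the affine
map onto the interval from -1 to 1. *)
Fixpoint leg (k : nat) : {poly R} :=
  if k is k'.+1 then
    if k' is k''.+1 then
      k%:R^-1 *: ((2 * k' + 1)%:R * u * leg k' - k'%:R * leg k'')
    else u
  else 1.

Arguments leg : simpl never.

(** For k = 0 the index k.-1 is truncated to 0, harmlessly since its coefficient
vanishes; the later recurrences use the same convention. *)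
Lemma bonnet k :
  k.+1%:R * leg k.+1 = (2 * k + 1)%:R * u * leg k - k%:R * leg k.-1.
Proof.
case: k => [|k]; first by rewrite /leg; ring.
rewrite [leg k.+2]/leg -/leg mulr_natl -scaler_nat scalerA mulfV ?scale1r // pnatr_eq0.
Qed.

Lemma polynatf_eq0 k : (k%:R == 0 :> {poly R}) = (k == 0)%N.
Proof. by rewrite -polyC_natr polyC_eq0 pnatr_eq0. Qed.

Lemma deriv_u : u^`() = 2%:R.
Proof. by rewrite /u derivB derivMn derivX derivC subr0. Qed.

Lemma deriv_bonnet k :
  k.+1%:R * (leg k.+1)^`() =
  (2 * k + 1)%:R * (2%:R * leg k + u * (leg k)^`()) - k%:R * (leg k.-1)^`().
Proof.
have := congr1 deriv (bonnet k).
by rewrite -mulrA !mulr_natl derivB !derivMn derivM deriv_u mulr_natl.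
Qed.

(** Differentiating Bonnet recurrence expresses the derivative in degree k + 2
through those in degrees k and k + 1; the induction closes since 4 v = 1 - u ^ 2. *)
Lemma leg_derivE k :
  2%:R * v * (leg k)^`() = k%:R * (leg k.-1 - u * leg k).
Proof.
suff: 2%:R * v * (leg k)^`() = k%:R * (leg k.-1 - u * leg k) /\
  2%:R * v * (leg k.+1)^`() = k.+1%:R * (leg k - u * leg k.+1) by case.
elim: k => [|k [IH1 IH2]].
  split; first by rewrite derivC; ring.
  by rewrite deriv_u /leg /u /v; ring.
split=> //; have nz : k.+2%:R != 0 :> {poly R} by rewrite polynatf_eq0.
apply: (mulfI nz).
have B1 : k.+2%:R * leg k.+2 =
    (2 * k.+1 + 1)%:R * u * leg k.+1 - k.+1%:R * leg k := bonnet k.+1.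
have D1 : k.+2%:R * (leg k.+2)^`() =
    (2 * k.+1 + 1)%:R * (2%:R * leg k.+1 + u * (leg k.+1)^`())
    - k.+1%:R * (leg k)^`() := deriv_bonnet k.+1.
have B0 := bonnet k.
rewrite [RHS]mulrCA mulrBr mulrCA D1 [X in _ = _ * (_ - X)]mulrCA B1.
transitivity ((2 * k.+1 + 1)%:R * (4%:R * v * leg k.+1
    + u * (2%:R * v * (leg k.+1)^`())) - k.+1%:R * (2%:R * v * (leg k)^`())).
  ring.
rewrite IH1 IH2.
have -> : k.+1%:R * (k%:R * (leg k.-1 - u * leg k)) =
    k.+1%:R * (k%:R * leg k.-1 - k%:R * (u * leg k)) by ring.
have -> : k%:R * leg k.-1 =
    (2 * k + 1)%:R * u * leg k - k.+1%:R * leg k.+1 by rewrite B0; ring.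
rewrite /u /v; ring.
Qed.

(** Eliminating [u * leg k] between [leg_derivE] and [bonnet] leaves only the two
neighbouring degrees, which is what both the coefficients and the moments need. *)
Lemma leg_ladder k :
  (2 * k + 1)%:R * (2%:R * v * (leg k)^`()) =
  (k * k.+1)%:R * (leg k.-1 - leg k.+1).
Proof.
rewrite leg_derivE; apply/eqP; rewrite -subr_eq0; apply/eqP.
transitivity (k%:R * (k.+1%:R * leg k.+1
    - ((2 * k + 1)%:R * u * leg k - k%:R * leg k.-1))); first by ring.
by rewrite bonnet subrr mulr0.
Qed.
End Legendre.

Arguments leg : simpl never.

(** * The Bernstein basis *)

Section BernsteinBasis.
Variable R : realType.
Implicit Types (n m : nat) (p q : {poly R}).

Let u : {poly R} := 'X *+ 2 - 1.
Let v : {poly R} := 'X * (1 - 'X).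

(** The basis is triangular with respect to the monomials: the i-th element is
divisible by the i-th power of the variable and by no higher power. *)
Lemma bernstein_free n (c : 'I_n.+1 -> R) :
  \sum_(i < n.+1) c i *: bernstein R n i = 0 -> forall i, c i = 0.
Proof.
move=> c0 i; have [m] := ubnP (i : nat); elim: m i => // m IH i im.
have /(congr1 (fun p : {poly R} => p`_i)) := c0.
rewrite coef0 coef_sum (bigD1 i) //= big1 ?addr0 => [|j ji]; last first.
  rewrite coefZ coefZ coefXnM; case: ltnP => ij; first by rewrite !mulr0.
  have lt_ji : (j < i)%N by rewrite ltn_neqAle ij andbT; exact: ji.
  by rewrite (IH j) ?mul0r // (leq_trans lt_ji).
rewrite !coefZ coefXnM ltnn subnn -horner_coef0.
have -> : ((1 - 'X) ^+ (n - i) : {poly R}).[0] = 1 by rewrite !hornerE subr0 expr1n.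
rewrite mulr1.
move/eqP; rewrite mulf_eq0 pnatr_eq0 -leqn0 leqNgt bin_gt0 -ltnS ltn_ord orbF.
by move/eqP.
Qed.

Lemma bernstein_inj n (c d : 'I_n.+1 -> R) :
  \sum_(i < n.+1) c i *: bernstein R n i =
  \sum_(i < n.+1) d i *: bernstein R n i -> c =1 d.
Proof.
move=> /eqP; rewrite -subr_eq0 -sumrB => /eqP cd i.
apply/eqP; rewrite -subr_eq0; apply/eqP.
apply: (bernstein_free (c := fun i => c i - d i)).
by under eq_bigr do rewrite scalerBl.
Qed.

Lemma mul_deriv_exp q n : q * (q ^+ n)^`() = n%:R * q^`() * q ^+ n.
Proof.
case: n => [|n]; first by rewrite expr0 derivC; ring.
by rewrite deriv_exp exprS /= -mulr_natl; ring.
Qed.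

Lemma bernstein_ladder n i : (i <= n)%N ->
  v * (bernstein R n i)^`() = (i%:R - n%:R * 'X) * bernstein R n i.
Proof.
move=> le_in; rewrite /bernstein -!scalerAr derivZ -scalerAr; congr (_ *: _).
have dX := @mul_deriv_exp 'X i; have dY := @mul_deriv_exp (1 - 'X) (n - i).
rewrite derivB derivC !derivX sub0r in dX dY.
pose x : {poly R} := 'X.
transitivity ((1 - x) * (x * (x ^+ i)^`()) * (1 - x) ^+ (n - i)
  + x * x ^+ i * ((1 - x) * ((1 - x) ^+ (n - i))^`())).
  by rewrite derivM /v /x; ring.
by rewrite dX dY /x natrB //; ring.
Qed.

Lemma sum_bernstein n : \sum_(i < n.+1) bernstein R n i = 1.
Proof.
transitivity ((1 - 'X + 'X : {poly R}) ^+ n); last by rewrite subrK expr1n.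
rewrite exprDn; apply: eq_bigr => i _.
by rewrite /bernstein scaler_nat mulrC.
Qed.

Lemma bernstein_deriv n i : (i < n)%N ->
  (bernstein R n.+1 i.+1)^`() =
  n.+1%:R * (bernstein R n i - bernstein R n i.+1).
Proof.
move=> lt_in; have [d nE] : exists d, n = (i + d.+1)%N.
  by exists (n - i.+1)%N; lia.
have E1 : i.+1%:R * 'C(n.+1, i.+1)%:R = n.+1%:R * 'C(n, i)%:R :> {poly R}.
  by rewrite -!natrM mul_bin_diag.
have E2 : d.+1%:R * 'C(n.+1, i.+1)%:R = n.+1%:R * 'C(n, i.+1)%:R :> {poly R}.
  by rewrite -!natrM (mul_bin_down n.+1 i.+1); congr ((_ * _)%:R); lia.
have [e1 e2 e3] :
    [/\ n.+1 - i.+1 = d.+1, n - i = d.+1 & n - i.+1 = d]%N by split; lia.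
rewrite /bernstein e1 e2 e3 !scaler_nat.
pose x : {poly R} := 'X.
transitivity (i.+1%:R * 'C(n.+1, i.+1)%:R * (x ^+ i * (1 - x) ^+ d.+1)
    - d.+1%:R * 'C(n.+1, i.+1)%:R * (x ^+ i.+1 * (1 - x) ^+ d)).
  rewrite /x derivMn derivM derivXn deriv_exp derivB derivC derivX /=; ring.
by rewrite E1 E2 /x; ring.
Qed.

(** By [bernstein_deriv], consecutive basis elements differ by the derivative of a
polynomial that vanishes at both ends, so all the integrals are equal; they sum
to 1. *)
Lemma int01_bernstein n i : (i <= n)%N -> int01 (bernstein R n i) = n.+1%:R^-1.
Proof.
have step j : (j < n)%N -> int01 (bernstein R n j) = int01 (bernstein R n j.+1).
  move=> lt_jn; apply/eqP; rewrite -subr_eq0 -raddfB /=.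
  have /eqP := int01_deriv (bernstein R n.+1 j.+1).
  rewrite bernstein_deriv // int01_natl.
  rewrite /bernstein; have -> : (n.+1 - j.+1 = (n - j.+1).+1)%N by lia.
  rewrite !hornerE subrr !expr0n /= !(mulr0, mul0r) subrr mulf_eq0 pnatr_eq0 /=.
  by [].
have const j : (j <= n)%N -> int01 (bernstein R n j) = int01 (bernstein R n 0).
  by elim: j => // j IH lt_jn; rewrite -step // IH // ltnW.
have total : int01 (1 : {poly R}) = 1.
  by rewrite -(derivX R) int01_deriv !hornerE subr0.
move=> le_in; rewrite const //.
have : n.+1%:R * int01 (bernstein R n 0) = 1.
  rewrite -[RHS]total -(sum_bernstein n) raddf_sum /=.
  rewrite [RHS](eq_bigr (fun=> int01 (bernstein R n 0))) => [|j _].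
    by rewrite sumr_const card_ord mulr_natl.
  by rewrite const // -ltnS.
by move=> /(canRL (mulKf _)) ->; rewrite ?mulr1 // pnatr_eq0.
Qed.

(** Multiply by the partition of unity [sum_bernstein] of degree n - m. *)
Lemma bernstein_elevation m n (j : 'I_m.+1) : (m <= n)%N ->
  bernstein R m j =
  \sum_(i < n.+1) elevation_mx R m n i j *: bernstein R n i.
Proof.
move=> le_mn; have le_jm : (j <= m)%N by rewrite -ltnS.
under eq_bigr do rewrite mxE.
pose F i := (if (j <= i)%N then ('C(m, j) * 'C(n - m, i - j))%:R / 'C(n, i)%:R
  else 0 : R) *: bernstein R n i.
rewrite -(big_mkord xpredT F) (big_cat_nat (n := j)) //=; last first.
  by rewrite (leq_trans le_jm) // ltnW.
rewrite big_nat big1 ?add0r => [|i /andP[_ ij]]; last first.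
  by rewrite /F leqNgt ij scale0r.
rewrite -[X in \sum_(X <= _ < _) _]add0n big_addn.
rewrite (big_cat_nat (n := (n - m).+1)) //=; last by lia.
rewrite [X in _ + X]big_nat [X in _ + X]big1 ?addr0 => [|i /andP[ni _]]; last first.
  by rewrite /F leq_addl addnK [X in (_ * X)%N]bin_small // muln0 mul0r scale0r.
rewrite big_mkord -[LHS]mulr1 -[X in _ * X](sum_bernstein (n - m)).
rewrite mulr_sumr; apply: eq_bigr => i _.
have le_in : (i <= n - m)%N by rewrite -ltnS.
rewrite /F leq_addl addnK scalerA divfK; last first.
  by rewrite pnatr_eq0 -lt0n bin_gt0; lia.
rewrite /bernstein natrM -scalerA -scalerAl; congr (_ *: _).
have -> : (n - (i + j) = (m - j) + (n - m - i))%N by lia.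
by rewrite -scalerAr !exprD; congr (_ *: _); ring.
Qed.

(** The monomial of degree j is the last Bernstein polynomial of degree j, which
degree elevation brings to degree n. *)
Lemma bernstein_span n p : (size p <= n.+1)%N ->
  exists c : 'I_n.+1 -> R, p = \sum_(i < n.+1) c i *: bernstein R n i.
Proof.
move=> sp; exists (fun i => \sum_(j < size p) p`_j * elevation_mx R j n i ord_max).
rewrite -[p in LHS]coefK poly_def.
under eq_bigr => j _.
  have -> : 'X^j = bernstein R j (@ord_max j).
    by rewrite /bernstein /= binn subnn expr0 mulr1 scale1r.
  rewrite (@bernstein_elevation j n); last first.
    by rewrite -ltnS (leq_trans (ltn_ord j)).
  rewrite scaler_sumr; over.
rewrite exchange_big; apply: eq_bigr => i _.
by rewrite scaler_suml; apply: eq_bigr => j _; rewrite scalerA.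
Qed.

End BernsteinBasis.

(** * Moments of the Legendre polynomials *)

Section Durrmeyer.
Variable R : realType.
Implicit Types (n k : nat) (p q : {poly R}).

Let u : {poly R} := 'X *+ 2 - 1.
Let v : {poly R} := 'X * (1 - 'X).

Definition moment n k i : R := int01 (bernstein R n i * leg R k).

(** The eigenvalue in product form: it agrees with [mass_eig] for k <= n, and is 0
for k > n, where the truncated factorial of [mass_eig] is not. This zero is the
source of orthogonality. *)
Definition durrmeyer_eig n k : R :=
  n.+1%:R^-1 * \prod_(j < k) ((n%:R - j%:R) / (n + j + 2)%:R).

Lemma durrmeyer_eigS n k :
  (n + k + 2)%:R * durrmeyer_eig n k.+1 = (n%:R - k%:R) * durrmeyer_eig n k.
Proof.
have nz : (n + k + 2)%:R != 0 :> R by rewrite pnatr_eq0 addn2.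
by rewrite /durrmeyer_eig big_ord_recr /= mulrC -!mulrA mulVf // mulr1 mulrA mulrC.
Qed.

Lemma mass_eigE n k : (k <= n)%N -> mass_eig R n k = durrmeyer_eig n k.
Proof.
elim: k => [|k IH] le_kn.
  rewrite /durrmeyer_eig big_ord0 mulr1 /mass_eig addn0 addn1 subn0 factS.
  rewrite -mulnA mulnn natrM invfM mulrCA divff ?mulr1 //.
have nz : (n + k + 2)%:R != 0 :> R by rewrite pnatr_eq0 addn2.
apply: (mulfI nz); rewrite durrmeyer_eigS -IH 1?ltnW // /mass_eig.
rewrite -natrB 1?ltnW //.
have [d dE] : exists d, (n - k = d.+1)%N by exists (n - k).-1; lia.
have -> : (n - k.+1 = d)%N by lia.
have -> : (n + k.+1 + 1 = (n + k + 1).+1)%N by lia.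
have fnz m : m`!%:R != 0 :> R by rewrite pnatr_eq0 -lt0n fact_gt0.
have -> : (n + k + 2 = (n + k + 1).+1)%N by lia.
rewrite dE !factS !natrM; field.
have [] : 0 <= d%:R :> R /\ 0 <= n%:R + k%:R :> R.
  by rewrite -natrD !ler0n.
by move=> d0 nk0; rewrite !fnz /= !lt0r_neq0 //; lra.
Qed.

(** Integrate the derivative of [v * bernstein R n i * p], which vanishes at both
ends; the index i comes from [bernstein_ladder]. *)
Lemma bernstein_index_by_parts n i p : (i <= n)%N ->
  ((2 * i)%:R - n%:R) * int01 (bernstein R n i * p) =
  int01 (bernstein R n i * ((n + 2)%:R * u * p - 2%:R * v * p^`())).
Proof.
move=> le_in; have L := bernstein_ladder R le_in.
have : int01 (v * bernstein R n i * p)^`() = 0.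
  have v0 : v.[0] = 0 by rewrite /v !hornerE.
  have v1 : v.[1] = 0 by rewrite /v !hornerE subrr.
  have at_end x : v.[x] = 0 -> (v * bernstein R n i * p).[x] = 0.
    by move=> vx; rewrite 2!hornerM vx !mul0r.
  by rewrite int01_deriv !at_end // subrr.
set b := bernstein R n i in L *.
have -> : (v * b * p)^`() = - u * b * p + v * b^`() * p + b * (v * p^`()).
  by rewrite !derivM derivB derivC derivX /u /v; ring.
rewrite L => by_parts; apply/eqP.
rewrite mulrBl -!int01_natl -raddfB /= -subr_eq0 -raddfB /=.
rewrite -(mulr0 2%:R) -by_parts -int01_natl; apply/eqP; congr int01.
by rewrite /u; ring.
Qed.

(** The dual of [bernstein_index_by_parts]: the index multiplies a coefficient
instead of a moment. *)
Lemma coef_index_ladder n (c : 'I_n.+1 -> R) p :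
  p = \sum_(i < n.+1) c i *: bernstein R n i ->
  \sum_(i < n.+1) (((2 * i)%:R - n%:R) * c i) *: bernstein R n i =
  2%:R * v * p^`() + n%:R * u * p.
Proof.
move=> ->; rewrite [deriv _]raddf_sum !mulr_sumr -big_split /=.
apply: eq_bigr => i _; rewrite derivZ.
have L := @bernstein_ladder R n i (ltn_ord i).
set b := bernstein R n i in L *.
rewrite -!mul_polyC polyCM polyCB !polyC_natr.
transitivity (2%:R * (c i)%:P * (v * b^`()) + n%:R * u * ((c i)%:P * b)).
  by rewrite L /u; ring.
by ring.
Qed.

Lemma momentS n k i : (i <= n)%N ->
  (k.+1 * (n + k + 2))%:R * moment n k.+1 i =
  (2 * k + 1)%:R * ((2 * i)%:R - n%:R) * moment n k i
  - k%:R * (n%:R + 1 - k%:R) * moment n k.-1 i.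
Proof.
move=> le_in; rewrite -mulrA /moment bernstein_index_by_parts //.
set b := bernstein R n i.
have -> : k%:R * (n%:R + 1 - k%:R) * int01 (b * leg R k.-1) =
    (k * n.+1)%:R * int01 (b * leg R k.-1) - (k * k)%:R * int01 (b * leg R k.-1).
  by ring.
rewrite -!int01_natl -!raddfB /=; congr int01.
have B := bonnet R k; have D := leg_ladder R k.
transitivity (b * ((n + 2)%:R * ((2 * k + 1)%:R * u * leg R k)
  - (2 * k + 1)%:R * (2%:R * v * (leg R k)^`()))
  - ((k * n.+1)%:R * (b * leg R k.-1) - (k * k)%:R * (b * leg R k.-1)));
  last by ring.
have -> : (2 * k + 1)%:R * u * leg R k = k.+1%:R * leg R k.+1 + k%:R * leg R k.-1.
  by rewrite B subrK.
by rewrite D; ring.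
Qed.

(** The left-hand side is the Bernstein-Durrmeyer operator applied to [leg R k]. By
[momentS] and [coef_index_ladder], its values satisfy the same
recurrence in k as the right-hand side. There is no bound on k. *)
Lemma durrmeyer_leg n k :
  \sum_(i < n.+1) moment n k i *: bernstein R n i = durrmeyer_eig n k *: leg R k.
Proof.
have moment0 i : (i <= n)%N -> moment n 0 i = n.+1%:R^-1.
  by move=> le_in; rewrite /moment mulr1 int01_bernstein.
pose D j := \sum_(i < n.+1) moment n j i *: bernstein R n i.
pose e j := durrmeyer_eig n j.
suff: D k.-1 = e k.-1 *: leg R k.-1 /\ D k = e k *: leg R k by case.
elim: k => [|k [IHp IH]] /=.
  suff: D 0 = e 0 *: leg R 0 by [].
  rewrite /D /e /durrmeyer_eig big_ord0 mulr1.
  rewrite -[X in _ = _ *: X](sum_bernstein R n) scaler_sumr.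
  by apply: eq_bigr => i _; rewrite moment0 // -ltnS.
split=> //.
have nz : (k.+1 * (n + k + 2))%:R != 0 :> R by rewrite pnatr_eq0 addn2.
apply: (scalerI nz).
transitivity ((2 * k + 1)%:R *: (\sum_(i < n.+1)
     (((2 * i)%:R - n%:R) * moment n k i) *: bernstein R n i)
   - (k%:R * (n%:R + 1 - k%:R)) *: D k.-1).
  rewrite !scaler_sumr -sumrB; apply: eq_bigr => i _.
  have le_in : (i <= n)%N by rewrite -ltnS.
  move: (bernstein R n i) => b.
  by rewrite !scalerA momentS // scalerBl !mulrA.
rewrite (coef_index_ladder (p := e k *: leg R k)) // IHp derivZ.
have Bk := bonnet R k; have Dk := leg_ladder R k.
(* The ratio of consecutive eigenvalues turns the coefficients of the moment
   recurrence into those of the coefficient recurrence. *)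
have ek : k%:R * (n%:R + 1 - k%:R) * e k.-1 = k%:R * (n + k + 1)%:R * e k.
  case: k {IHp IH nz Bk Dk} => [|k]; first by ring.
  rewrite -!mulrA; congr (_ * _); have := durrmeyer_eigS n k.
  rewrite -/(e _) -/(e _) => E.
  have -> : (n + k.+1 + 1 = n + k + 2)%N by lia.
  by rewrite E /=; ring.
have eS : (k.+1 * (n + k + 2))%:R * e k.+1 = k.+1%:R * (n%:R - k%:R) * e k.
  by rewrite natrM -mulrA durrmeyer_eigS mulrA.
rewrite !scalerA ek eS; move: (e k) => c.
rewrite -!mul_polyC !polyCM !polyCB !polyC_natr.
transitivity (c%:P * ((2 * k + 1)%:R * (2%:R * v * (leg R k)^`())
   + n%:R * ((2 * k + 1)%:R * u * leg R k))
   - k%:R * (n + k + 1)%:R * c%:P * leg R k.-1); first by ring.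
have -> : (2 * k + 1)%:R * u * leg R k = k.+1%:R * leg R k.+1 + k%:R * leg R k.-1.
  by rewrite Bk subrK.
by rewrite Dk; ring.
Qed.

End Durrmeyer.

(** * Orthogonality, norm and uniqueness of the Legendre polynomials *)

Section LegendreCharacterization.
Variable R : realType.
Implicit Types (n k : nat) (p q : {poly R}).

Lemma size_leg k : (size (leg R k) <= k.+1)%N.
Proof.
suff: (size (leg R k) <= k.+1)%N /\ (size (leg R k.+1) <= k.+2)%N by case.
pose u : {poly R} := 'X *+ 2 - 1.
have sizeu : (size u <= 2)%N.
  apply: leq_trans (size_polyD _ _) _; rewrite geq_max size_polyN size_poly1 andbT.
  by rewrite -scaler_nat (leq_trans (size_scale_leq _ _)) // size_polyX.
elim: k => [|k [IH IHS]]; first by rewrite /leg size_poly1.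
split=> //; rewrite /leg -/leg (leq_trans (size_scale_leq _ _)) //.
apply: leq_trans (size_polyD _ _) _; rewrite geq_max size_polyN.
have size_natl m (p : {poly R}) : (size (m%:R * p)%R <= size p)%N.
  by rewrite mulr_natl -scaler_nat size_scale_leq.
rewrite -mulrA; apply/andP; split; apply: leq_trans (size_natl _ _) _.
  by apply: leq_trans (size_polyMleq _ _) _; move: sizeu IHS; rewrite -/u;
  move: (size u) (size (leg R k.+1)) => a b; lia.
by apply: leq_trans IH _; lia.
Qed.

Lemma leg_horner1 k : (leg R k).[1] = 1.
Proof.
suff: (leg R k).[1] = 1 /\ (leg R k.+1).[1] = 1 by case.
elim: k => [|k [IH IHS]]; first by rewrite /leg !hornerE; split=> //; ring.
split=> //; have nz : k.+2%:R != 0 :> R by rewrite pnatr_eq0.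
apply: (mulfI nz); have /(congr1 (horner^~ 1)) := bonnet R k.+1.
rewrite /= -!polyC_natr !(hornerD, hornerN, hornerM, hornerMn, hornerX, hornerC).
by rewrite IH IHS => ->; ring.
Qed.

(** For k = n + 1 the eigenvalue [durrmeyer_eig R n k] is 0, so [durrmeyer_leg] and
[bernstein_free] annihilate the moments of [leg R k] against a basis of the
polynomials of degree at most n. *)
Lemma leg_orthogonal k q : (size q <= k)%N -> int01 (leg R k * q) = 0.
Proof.
case: k => [|n].
  by rewrite leqn0 size_poly_eq0 => /eqP ->; rewrite mulr0 raddf0.
have eig0 : durrmeyer_eig R n n.+1 = 0.
  by rewrite /durrmeyer_eig big_ord_recr /= subrr mul0r !mulr0.
have := durrmeyer_leg R n n.+1; rewrite eig0 scale0r => /bernstein_free moment0.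
move=> /bernstein_span[c ->]; rewrite mulr_sumr raddf_sum /=.
apply: big1 => i _; rewrite -scalerAr int01Z mulrC [leg R _ * _]mulrC.
by rewrite [int01 _]moment0 mul0r.
Qed.

(** Pairing Bonnet recurrence for two consecutive degrees with the neighbouring
polynomial expresses the integral of [u * leg k * leg k.+1] in two ways. *)
Lemma leg_norm k : int01 (leg R k * leg R k) = (2 * k + 1)%:R^-1.
Proof.
elim: k => [|k IH].
  rewrite -[leg R 0]/(1 : {poly R}) mulr1 -(derivX R).
  by rewrite int01_deriv !hornerE subr0 invr1.
have nz m : m.+1%:R != 0 :> R by rewrite pnatr_eq0.
have B0 := congr1 (fun p => int01 (p * leg R k.+1)) (bonnet R k).
have B1 := congr1 (fun p => int01 (p * leg R k)) (bonnet R k.+1).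
rewrite /= !mulrBl !raddfB /= -!mulrA !int01_natl in B0 B1.
have Z0 : int01 (leg R k.-1 * leg R k.+1) = 0.
  rewrite mulrC leg_orthogonal //.
  by apply: leq_trans (size_leg _) _; rewrite ltnS leq_pred.
have Z1 : int01 (leg R k.+2 * leg R k) = 0.
  by rewrite leg_orthogonal // (leq_trans (size_leg _)).
rewrite Z0 mulr0 subr0 in B0; rewrite Z1 mulr0 IH in B1.
move/esym/eqP: B1; rewrite subr_eq0 => /eqP B1.
rewrite [leg R k * leg R k.+1]mulrC in B0.
have d1 : (2 * k + 1)%:R != 0 :> R by rewrite addn1 nz.
have d3 : (2 * k.+1 + 1)%:R != 0 :> R by rewrite addn1 nz.
apply: (mulfI (nz k)); apply: (mulfI d3).
rewrite B0 mulrCA B1 mulrCA divff // mulr1.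
by rewrite [in RHS]mulrCA divff // mulr1.
Qed.

Lemma leg_neq0 k : leg R k != 0.
Proof.
apply/eqP => L0; have := leg_horner1 k; rewrite L0 horner0 => /esym/eqP.
by rewrite oner_eq0.
Qed.

(** A smaller degree would make [leg R k] orthogonal to itself, against [leg_norm]. *)
Lemma size_leg_eq k : size (leg R k) = k.+1.
Proof.
apply/eqP; rewrite eqn_leq size_leg /= ltnNge; apply/negP => /leg_orthogonal.
by rewrite leg_norm => /eqP; rewrite invr_eq0 pnatr_eq0 addn1.
Qed.

Lemma leg_lead_neq0 k : (leg R k)`_k != 0.
Proof.
by rewrite -[k in _`_k](congr1 predn (size_leg_eq k)) lead_coef_eq0 leg_neq0.
Qed.

(** Subtracting a multiple of [leg R k] removes the coefficient of degree k, and
pairing with [leg R k] shows that this multiple was zero. *)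
Lemma poly_orthogonal_eq0 k q : (size q <= k)%N ->
  (forall j, (j < k)%N -> int01 (leg R j * q) = 0) -> q = 0.
Proof.
elim: k => [|k IH] in q *; first by rewrite leqn0 size_poly_eq0 => /eqP.
move=> sq orth; have lnz := leg_lead_neq0 k.
have drop p : (size p <= k.+1)%N -> p`_k = 0 -> (size p <= k)%N.
  move=> sp pk; apply/leq_sizeP => j; rewrite leq_eqVlt => /predU1P[<- //|].
  by move/leq_sizeP: sp; apply.
suff qk : q`_k = 0 by apply: IH => [|j jk]; [exact: drop|exact/orth/ltnW].
pose r := q - (q`_k / (leg R k)`_k) *: leg R k.
have sr : (size r <= k)%N.
  apply: drop; last by rewrite coefB coefZ divfK // subrr.
  apply: leq_trans (size_polyD _ _) _; rewrite geq_max sq size_polyN /=.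
  by rewrite (leq_trans (size_scale_leq _ _)) // size_leg.
have := leg_orthogonal sr; rewrite mulrBr raddfB /= orth // sub0r.
rewrite -scalerAr int01Z leg_norm => /eqP; rewrite oppr_eq0 !mulf_eq0 !invr_eq0.
by rewrite pnatr_eq0 addn1 orbF (negPf lnz) orbF => /eqP.
Qed.

Lemma legendreE k : legendre R k = leg R k.
Proof.
have Hleg : is_shifted_legendre k (leg R k).
  split=> [|q sq|]; [exact: size_leg_eq| |exact: leg_horner1].
  by rewrite L2dotE leg_orthogonal.
rewrite /legendre; case: xgetP => [p _ [sp orth p1]|/(_ (leg R k))//].
have [a pE] : exists a, p = a *: leg R k.
  exists (p`_k / (leg R k)`_k); apply/eqP; rewrite -subr_eq0; apply/eqP.
  have lnz := leg_lead_neq0 k.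
  have sp' : (size p <= k.+1)%N by rewrite sp.
  apply: (@poly_orthogonal_eq0 k) => [|j jk].
    apply/leq_sizeP => j; rewrite leq_eqVlt => /predU1P[<-|kj].
      by rewrite coefB coefZ divfK // subrr.
    have vanish r : size r = k.+1 -> r`_j = 0 by move=> sr; rewrite nth_default // sr.
    by rewrite coefB coefZ !vanish ?size_leg_eq // mulr0 subr0.
  have sj : (size (leg R j) <= k)%N by rewrite size_leg_eq.
  rewrite mulrBr raddfB /= mulrC -L2dotE orth // -scalerAr int01Z.
  by rewrite [leg R j * _]mulrC leg_orthogonal // mulr0 subrr.
by move: p1; rewrite pE hornerZ leg_horner1 mulr1 => ->; rewrite scale1r.
Qed.

End LegendreCharacterization.

(** * The eigendecomposition of the mass matrix *)

Section Eigendecomposition.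
Variable R : realType.
Implicit Types (n k : nat) (p q : {poly R}).

Definition leg_coef n k : 'cV[R]_n.+1 :=
  elevation_mx R k n *m bernstein_coef k (legendre R k).

Lemma leg_coefE n k : (k <= n)%N ->
  \sum_(i < n.+1) leg_coef n k i 0 *: bernstein R n i = leg R k.
Proof.
move=> le_kn; rewrite /leg_coef; set c := bernstein_coef _ _.
have cE : leg R k = \sum_(j < k.+1) c j 0 *: bernstein R k j.
  rewrite -legendreE.
  apply: (@xgetPex _ 0
    [set c : 'cV[R]_k.+1 | legendre R k = \sum_(i < k.+1) c i 0 *: bernstein R k i]).
  rewrite legendreE; have [d ->] := bernstein_span (size_leg R k).
  by exists (\col_i d i); apply: eq_bigr => i _; rewrite mxE.
rewrite [RHS]cE.
under [RHS]eq_bigr do rewrite (bernstein_elevation R _ le_kn) scaler_sumr.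
rewrite exchange_big; apply: eq_bigr => i _.
by rewrite mxE scaler_suml; apply: eq_bigr => j _; rewrite scalerA mulrC.
Qed.

Lemma durrmeyer_eig_gt0 n k : (k <= n)%N -> 0 < durrmeyer_eig R n k.
Proof.
move=> le_kn; rewrite -mass_eigE // /mass_eig.
by rewrite divr_gt0 // ltr0n ?muln_gt0 ?expn_gt0 ?fact_gt0.
Qed.

(** Both sides are coefficients of one polynomial, by [durrmeyer_leg]
and [leg_coefE]. *)
Lemma moment_leg_coef n k (i : 'I_n.+1) : (k <= n)%N ->
  moment R n k i = durrmeyer_eig R n k * leg_coef n k i 0.
Proof.
move=> le_kn; move: i.
apply: (bernstein_inj (d := fun i => durrmeyer_eig R n k * leg_coef n k i 0)).
rewrite durrmeyer_leg -(leg_coefE le_kn) scaler_sumr.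
by apply: eq_bigr => i _; rewrite scalerA.
Qed.

Lemma mass_mx_leg_coef n k (i : 'I_n.+1) : (k <= n)%N ->
  \sum_j mass_mx R n i j * leg_coef n k j 0 = moment R n k i.
Proof.
move=> le_kn; rewrite /moment -(leg_coefE le_kn) mulr_sumr raddf_sum /=.
apply: eq_bigr => j _; rewrite mxE L2dotE; move: (bernstein R n j) => b.
by rewrite -scalerAr int01Z mulrC.
Qed.

(** An eigenvalue times a dot product of coefficient vectors is a pairing
of coefficients with moments, that is, an integral. *)
Lemma leg_coef_dot n j k : (j <= n)%N -> (k <= n)%N ->
  durrmeyer_eig R n k * (\sum_i leg_coef n j i 0 * leg_coef n k i 0) =
  (j == k)%:R / (2 * k + 1)%:R.
Proof.
move=> le_jn le_kn; transitivity (int01 (leg R j * leg R k)).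
  rewrite -[in RHS](leg_coefE le_jn) mulr_suml raddf_sum /= mulr_sumr.
  apply: eq_bigr => i _.
  have := moment_leg_coef i le_kn; rewrite /moment.
  by move: (bernstein R n i) => b mE; rewrite -[in RHS]scalerAl int01Z mE; ring.
case: (ltngtP j k) => [jk|kj|->]; last by rewrite leg_norm mul1r.
  by rewrite mulrC leg_orthogonal ?mul0r // size_leg_eq.
by rewrite leg_orthogonal ?mul0r // size_leg_eq.
Qed.

Lemma mass_eigvecE n (i k : 'I_n.+1) : mass_eigvec_mx R n i k =
  Num.sqrt ((2 * k + 1)%:R * durrmeyer_eig R n k) * leg_coef n k i 0.
Proof. by rewrite mxE mxE mass_eigE // -ltnS. Qed.

Lemma mass_eigvec_orthogonal n : orthogonal_mx (mass_eigvec_mx R n).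
Proof.
suff QTQ : (mass_eigvec_mx R n)^T *m mass_eigvec_mx R n = 1%:M.
  by split=> //; apply: mulmx1C.
apply/matrixP => j k; rewrite !mxE.
under eq_bigr do rewrite mxE !mass_eigvecE mulrACA.
have [le_jn le_kn] : (j <= n)%N /\ (k <= n)%N by split; rewrite -ltnS.
have e0 := durrmeyer_eig_gt0 le_kn; have d0 : 0 < (2 * k + 1)%:R :> R.
  by rewrite ltr0n addn1.
rewrite -mulr_sumr; have /(canRL (mulKf (lt0r_neq0 e0))) -> := leg_coef_dot le_jn le_kn.
have [-> | /negPf jk] := eqVneq j k; last first.
  by rewrite -val_eqE in jk; rewrite jk mul0r !mulr0.
rewrite eqxx -expr2 sqr_sqrtr ?(mulr_ge0 (ltW d0) (ltW e0)) //.
move: (durrmeyer_eig R n k) ((2 * k + 1)%:R : R) e0 d0 => e d e0 d0.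
by rewrite mulr1n; field; rewrite !lt0r_neq0.
Qed.

(** The vectors [leg_coef n k] are eigenvectors because the mass matrix turns
coefficients into moments; orthogonality inverts the eigenvector matrix. *)
Lemma mass_mx_eigendecomposition n :
  mass_mx R n =
  mass_eigvec_mx R n *m mass_eig_mx R n *m (mass_eigvec_mx R n)^T.
Proof.
have MQ : mass_mx R n *m mass_eigvec_mx R n =
    mass_eigvec_mx R n *m mass_eig_mx R n.
  apply/matrixP => i k; have le_kn : (k <= n)%N by rewrite -ltnS.
  rewrite mul_mx_diag [RHS]mxE [X in _ = _ * X]mxE [LHS]mxE mass_eigvecE mass_eigE //.
  under eq_bigr do rewrite mass_eigvecE mulrCA.
  by rewrite -mulr_sumr mass_mx_leg_coef // moment_leg_coef //; ring.
by rewrite -MQ -mulmxA (mass_eigvec_orthogonal n).2 mulmx1.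
Qed.

End Eigendecomposition.

(** * A program logic with cost bounds *)

Section ProgramLogic.
Variable R : realType.
Implicit Types (c : cmd) (s : state R) (Q : state R -> Prop).

Definition runs c s (b : nat) Q : Prop :=
  exists t s', [/\ exec c s t s', (t <= b)%N & Q s'].

Lemma runs_weaken c s b b' Q Q' : (b <= b')%N -> (forall s, Q s -> Q' s) ->
  runs c s b Q -> runs c s b' Q'.
Proof.
move=> bb' QQ' [t [s' [ex tb Qs]]]; exists t, s'.
by split=> //; [exact: leq_trans bb' | exact: QQ'].
Qed.

Lemma runs_Seq c1 c2 s b1 b2 Q :
  runs c1 s b1 (fun s' => runs c2 s' b2 Q) -> runs (Seq c1 c2) s (b1 + b2) Q.
Proof.
move=> [t1 [s1 [ex1 tb1 [t2 [s2 [ex2 tb2 Qs]]]]]]; exists (t1 + t2)%N, s2.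
by split=> //; [exact: exec_Seq ex1 ex2 | exact: leq_add].
Qed.

Lemma runs_ISet x e s Q : Q (set_ivar s x (ieval s e)) -> runs (ISet x e) s 0 Q.
Proof.
by move=> Qs; exists 0%N, (set_ivar s x (ieval s e)); split=> //; exact: exec_ISet.
Qed.

Lemma runs_RSet a e1 e2 r s Q : rsafe s r ->
  Q (set_cell s a (ieval s e1) (ieval s e2) (reval s r)) ->
  runs (RSet a e1 e2 r) s (rcost r) Q.
Proof.
move=> safe Qs; exists (rcost r), (set_cell s a (ieval s e1) (ieval s e2) (reval s r)).
by split=> //; exact: exec_RSet.
Qed.

(** The bound [e] is evaluated again at each test, so [runs_For] asks for an
invariant that keeps its value. *)
Definition For (x : nat) (e : iexp) (body : cmd) : cmd :=
  Seq (ISet x (ILit 0))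
    (While (IVar x, e) (Seq body (ISet x (IAdd (IVar x) (ILit 1))))).

Lemma runs_For x e body (N b : nat) (Inv : nat -> state R -> Prop) s :
  (forall k s, Inv k s -> ivar s x = k /\ ieval s e = N) ->
  (forall k s, (k < N)%N -> Inv k s ->
     runs body s b (fun s' => Inv k.+1 (set_ivar s' x (ivar s' x).+1))) ->
  Inv 0%N (set_ivar s x 0) ->
  runs (For x e body) s (N * b) (Inv N).
Proof.
move=> InvE step Inv0; apply: (@runs_Seq _ _ _ 0); apply: runs_ISet => /=.
suff loop d k s' : (k + d = N)%N -> Inv k s' ->
    runs (While (IVar x, e) (Seq body (ISet x (IAdd (IVar x) (ILit 1))))) s'
      (d * b) (Inv N) by exact: loop Inv0.
elim: d k s' => [|d IH] k s' kdN Invk; have [xk eN] := InvE _ _ Invk.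
  rewrite addn0 in kdN; exists 0%N, s'; split=> //; last by rewrite -kdN.
  by apply: exec_WhileF; rewrite /test /= xk eN kdN ltnn.
have kN : (k < N)%N by lia.
have [t1 [s1 [ex1 tb1 Inv1]]] := step _ _ kN Invk.
have [|t2 [s2 [ex2 tb2 Inv2]]] := IH k.+1 _ _ Inv1; first by lia.
exists (t1 + 0 + t2)%N, s2; split=> //; last by rewrite addn0 mulSn leq_add.
apply: exec_WhileT ex2; first by rewrite /test /= xk eN.
apply: exec_Seq ex1 _.
have -> : (ivar s1 x).+1 = ieval s1 (IAdd (IVar x) (ILit 1)) by rewrite /= addn1.
exact: exec_ISet.
Qed.

End ProgramLogic.

(** * The program *)

Section Program.

(* Variable 0 holds the input, 1 the current degree, 2 the row index. Array 0
   receives the eigenvectors, array 1 the eigenvalues; array 2 is a table of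
   natural numbers as reals, and array 3 holds the moments, one degree per row. *)
Let n : iexp := IVar 0.
Let k : iexp := IVar 1.
Let i : iexp := IVar 2.

(** Indices cannot be converted to reals, so numbers up to 2 n + 2, the largest one
that the recurrences use, are read from a table built by repeated addition. *)
Definition nat_real (e : iexp) : rexp := RCell 2 e (ILit 0).

Definition fill_table : cmd :=
  For 1 (IAdd (IAdd n n) (ILit 2))
    (RSet 2 (IAdd k (ILit 1)) (ILit 0) (RAdd (nat_real k) (RLit 1))).

Definition inv_dim : rexp := RDiv (RLit 1) (nat_real (IAdd n (ILit 1))).

Definition fill_moment0 : cmd :=
  For 2 (IAdd n (ILit 1)) (RSet 3 (ILit 0) i inv_dim).

Definition two_k_plus_1 : rexp := nat_real (IAdd (IAdd k k) (ILit 1)).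

Definition eig_k : rexp := RCell 1 k k.

Definition set_eigvec : cmd :=
  RSet 0 i k
    (RMul (RSqrt (RMul two_k_plus_1 eig_k)) (RDiv (RCell 3 k i) eig_k)).

(** The recurrence [momentS] solved for the moment of degree k + 1. When k = 0 the
term at the truncated index k - 1 has coefficient 0. *)
Definition set_moment : cmd :=
  RSet 3 (IAdd k (ILit 1)) i
    (RDiv
      (RSub
        (RMul (RMul two_k_plus_1 (RSub (nat_real (IAdd i i)) (nat_real n)))
           (RCell 3 k i))
        (RMul (RMul (nat_real k) (nat_real (ISub (IAdd n (ILit 1)) k)))
           (RCell 3 (ISub k (ILit 1)) i)))
      (RMul (nat_real (IAdd k (ILit 1))) (nat_real (IAdd (IAdd n k) (ILit 2))))).

Definition set_eig : cmd :=
  RSet 1 (IAdd k (ILit 1)) (IAdd k (ILit 1))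
    (RDiv (RMul (nat_real (ISub n k)) eig_k)
       (nat_real (IAdd (IAdd n k) (ILit 2)))).

Definition eigendecomposition_prog : cmd :=
  Seq fill_table
  (Seq (RSet 1 (ILit 0) (ILit 0) inv_dim)
  (Seq fill_moment0
  (For 1 (IAdd n (ILit 1))
    (Seq (For 2 (IAdd n (ILit 1)) (Seq set_eigvec set_moment)) set_eig)))).

End Program.

(** * Correctness and cost of the program *)

Section Correctness.
Variables (R : realType) (n : nat).
Implicit Types (s : state R) (k i : nat).

Let eig k : R := durrmeyer_eig R n k.
Let mom k i : R := moment R n k i.
Let vec k i : R := Num.sqrt ((2 * k + 1)%:R * eig k) * (mom k i / eig k).

Definition has_input s := ivar s 0 = n.
Definition has_table s m := forall j, (j <= m)%N -> cell s 2 j 0 = j%:R.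
Definition has_eig s k :=
  (forall j, (j <= k)%N -> cell s 1 j j = eig j) /\
  (forall a b, a != b -> cell s 1 a b = 0).
Definition has_moment s k i := cell s 3 k i = mom k i.
Definition has_eigvec s k i := cell s 0 i k = vec k i.

(** What holds before the pass for degree k: eigenvalues and moments are known up
to degree k, eigenvectors below degree k. *)
Definition ready s k :=
  [/\ has_input s, has_table s (2 * n + 2), has_eig s k,
      forall j i, (j <= k)%N -> (i <= n)%N -> has_moment s j i
    & forall j i, (j < k)%N -> (i <= n)%N -> has_eigvec s j i].

Lemma set_eig_correct s k : (k <= n)%N -> ivar s 1 = k -> ready s k ->
  (forall i, (i <= n)%N -> has_moment s k.+1 i /\ has_eigvec s k i) ->
  runs set_eig s 2 (fun s' => ivar s' 1 = k /\ ready s' k.+1).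
Proof.
move=> le_kn ks [ns tab [eigs offdiag] moms vecs] new.
have tabE j : (j <= 2 * n + 2)%N -> cell s 2 j 0 = j%:R := tab j.
rewrite /has_input in ns; apply: runs_RSet.
  by rewrite /= ks ns tabE ?pnatr_eq0 ?addn2 //; lia.
split=> //; split=> //.
- split=> [j | a b ab] /=; rewrite ks addn1.
    rewrite andbb leq_eqVlt; case: eqP => [-> _ | _ /= jk]; last by rewrite eigs.
    rewrite ns !tabE; try lia; rewrite eigs // natrB // -durrmeyer_eigS.
    by rewrite mulrC mulKf // pnatr_eq0 addn2.
  have -> : (a == k.+1) && (b == k.+1) = false; last exact: offdiag.
  by apply: contraNF ab => /andP[/eqP-> /eqP->].
- move=> j i; rewrite leq_eqVlt => /predU1P[->|jk] le_in; last exact: moms.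
  exact: (new _ le_in).1.
- move=> j i; rewrite ltnS leq_eqVlt => /predU1P[->|jk] le_in; last exact: vecs.
  exact: (new _ le_in).2.
Qed.

Definition row_done s k i := forall j, (j < i)%N ->
  has_moment s k.+1 j /\ has_eigvec s k j.

Lemma set_entry_correct s k i : (k <= n)%N -> (i <= n)%N ->
  ivar s 1 = k -> ivar s 2 = i -> ready s k -> row_done s k i ->
  runs (Seq set_eigvec set_moment) s 12
    (fun s' => [/\ ivar s' 1 = k, ivar s' 2 = i, ready s' k & row_done s' k i.+1]).
Proof.
move=> le_kn le_in ks is_ [ns tab [eigs offdiag] moms vecs] row.
rewrite /has_input in ns.
have tabE j : (j <= 2 * n + 2)%N -> cell s 2 j 0 = j%:R := tab j.
have momE j l : (j <= k)%N -> (l <= n)%N -> cell s 3 j l = mom j l := @moms j l.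
have eig_gt0 : 0 < eig k by exact: durrmeyer_eig_gt0.
have two_k : (k + k + 1 = 2 * k + 1)%N by lia.
apply: (@runs_Seq _ _ _ _ 4 8); apply: runs_RSet.
  rewrite /= ks two_k tabE; last by lia.
  by rewrite eigs // mulr_ge0 ?ler0n ?(ltW eig_gt0) // (lt0r_neq0 eig_gt0).
apply: runs_RSet => /=; rewrite ks ?is_ ns.
  by rewrite !tabE ?mulf_neq0 ?pnatr_eq0 //; lia.
have vecE : Num.sqrt (cell s 2 (k + k + 1) 0 * cell s 1 k k) *
    (cell s 3 k i / cell s 1 k k) = vec k i.
  by rewrite two_k tabE ?eigs ?momE //; lia.
have newE : (cell s 2 (k + k + 1) 0 * (cell s 2 (i + i) 0 - cell s 2 n 0) *
    cell s 3 k i - cell s 2 k 0 * cell s 2 (n + 1 - k) 0 * cell s 3 (k - 1) i) /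
    (cell s 2 (k + 1) 0 * cell s 2 (n + k + 2) 0) = mom k.+1 i.
  rewrite two_k !tabE; try lia.
  rewrite !momE // ?(leq_trans (leq_subr _ _)) // natrB; last by lia.
  have nz : (k.+1 * (n + k + 2))%:R != 0 :> R by rewrite pnatr_eq0 addn2.
  apply: (mulfI nz); rewrite momentS // [(k + 1)%N]addn1 -natrM mulrC divfK //.
  by rewrite subn1 addnn -mul2n [(n + 1)%:R]natrD.
rewrite vecE newE addn1.
split=> //; [split=> // | ].
- move=> j l jk le_ln; rewrite /has_moment /=.
  by rewrite (ltn_eqF (leq_ltn_trans jk (ltnSn k))) momE.
- move=> j l jk le_ln; rewrite /has_eigvec /= (ltn_eqF jk) andbF; exact: vecs.
- move=> j; rewrite /has_moment /has_eigvec /= !eqxx andbT /= ltnS leq_eqVlt.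
  case: eqP => [-> //|_ /= ji]; exact: row.
Qed.

Lemma step_correct s k : (k <= n)%N -> ivar s 1 = k -> ready s k ->
  runs (Seq (For 2 (IAdd (IVar 0) (ILit 1)) (Seq set_eigvec set_moment)) set_eig)
    s (n.+1 * 12 + 2) (fun s' => ivar s' 1 = k /\ ready s' k.+1).
Proof.
move=> le_kn ks rdy; apply: runs_Seq.
pose Inv i s' := [/\ ivar s' 2 = i, ivar s' 1 = k, ready s' k & row_done s' k i].
apply: (@runs_weaken _ _ _ _ _ (Inv n.+1)) (leqnn _) _ _.
  move=> s' [_ ks' rdy' row]; exact: set_eig_correct.
apply: (runs_For (Inv := Inv)) => [i s' [is' _ [ns' _ _ _ _] _] | i s' le_in Invi |].
- by rewrite /= is' ns' addn1.
- have [is' ks' rdy' row] := Invi.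
  apply: runs_weaken (set_entry_correct le_kn le_in ks' is' rdy' row) => //.
  by move=> s'' [ks'' is'' rdy'' row'']; split=> //=; rewrite is''.
- by split=> // j.
Qed.

Lemma fill_table_correct :
  runs fill_table (init_state R n) (2 * n + 2)
    (fun s => [/\ has_input s, has_table s (2 * n + 2)
       & forall a j l, a != 2%N -> cell s a j l = 0]).
Proof.
pose Inv m s := [/\ ivar s 1 = m, has_input s, has_table s m
  & forall a j l, a != 2%N -> cell s a j l = 0].
apply: (@runs_weaken _ _ _ ((2 * n + 2) * 1) _ (Inv (2 * n + 2)%N)).
- by rewrite muln1.
- by move=> s [].
apply: (runs_For (Inv := Inv)) => [m s [ms ns _ _] | m s lt_m [ms ns tab zero] |].
- by rewrite /= ms ns; split=> //; lia.
- apply: runs_RSet => //; split=> [||j|a j l a2] /=; rewrite ?ms //.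
    rewrite addn1 leq_eqVlt andbT; case: eqP => [-> _|_ /= jm]; last exact: tab.
    by rewrite (tab m) // natr1.
  by rewrite (negPf a2) /= zero.
- by split=> //= j; rewrite leqn0 => /eqP ->.
Qed.

(** The n + 1 passes over n + 1 entries of at most 12 operations each dominate; 18
absorbs the initial loops and the eigenvalues. *)
Lemma prog_correct :
  runs eigendecomposition_prog (init_state R n) (18 * n.+1 ^ 2) (ready ^~ n.+1).
Proof.
apply: (@runs_weaken _ _ _
  (2 * n + 2 + (1 + (n.+1 * 1 + n.+1 * (n.+1 * 12 + 2)))) _ (ready ^~ n.+1)) => //.
  by rewrite expnS expn1; nia.
apply: runs_Seq; apply: runs_weaken (leqnn _) _ fill_table_correct.
move=> s [ns tab zero].
have tabE j : (j <= 2 * n + 2)%N -> cell s 2 j 0 = j%:R := tab j.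
rewrite /has_input in ns.
have nz : n.+1%:R != 0 :> R by rewrite pnatr_eq0.
have mom0 i : (i <= n)%N -> mom 0 i = n.+1%:R^-1.
  move=> le_in; rewrite /mom /moment -[leg R 0]/(1 : {poly R}) mulr1.
  exact: int01_bernstein.
apply: (@runs_Seq _ _ _ _ 1); apply: runs_RSet => /=; rewrite ns addn1 tabE //; try lia.
apply: runs_Seq.
pose Inv1 i s' := [/\ ivar s' 2 = i, has_input s', has_table s' (2 * n + 2),
   has_eig s' 0 & forall j, (j < i)%N -> has_moment s' 0 j].
apply: (@runs_weaken _ _ _ _ _ (Inv1 n.+1)) (leqnn _) _ _; last first.
  apply: (runs_For (Inv := Inv1)) => [i s' [is' ns' _ _ _] | i s' le_in | ].
  - by rewrite /= is' ns' addn1.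
  - case=> is' ns' tab' eig' mom'; rewrite /has_input in ns'.
    have tabE' : cell s' 2 n.+1 0 = n.+1%:R by apply: tab'; lia.
    apply: runs_RSet => /=; rewrite ns' addn1 tabE' //.
    split=> //=; first by rewrite is'.
    move=> j; rewrite /has_moment /= is' ltnS leq_eqVlt.
    by case: eqP => [-> _|_ /= ji]; [rewrite mom0 // mul1r | exact: mom'].
  - split=> //; split=> [j|a b ab] /=.
      rewrite leqn0 => /eqP ->; rewrite /= mul1r.
      by rewrite /eig /durrmeyer_eig big_ord0 mulr1.
    have -> : (a == 0%N) && (b == 0%N) = false; last exact: zero.
    by apply: contraNF ab => /andP[/eqP-> /eqP->].
move=> s' [_ ns' tab' eig' mom'].
pose Inv2 k s' := ivar s' 1 = k /\ ready s' k.
apply: (@runs_weaken _ _ _ _ _ (Inv2 n.+1)) (leqnn _) _ _; first by move=> s'' [].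
apply: (runs_For (Inv := Inv2)) =>
  [k s'' [ks'' [ns'' _ _ _ _]] | k s'' le_kn [ks'' rdy] |].
- by rewrite /= ks'' ns'' addn1.
- apply: runs_weaken (step_correct le_kn ks'' rdy) => //.
  by move=> s3 [ks3 rdy3]; split=> //=; rewrite ks3.
- split=> //; split=> // j i; first by rewrite leqn0 => /eqP ->; exact: mom'.
Qed.

Lemma ready_outputs s : ready s n.+1 ->
  array_mx n.+1 s 0 = mass_eigvec_mx R n /\ array_mx n.+1 s 1 = mass_eig_mx R n.
Proof.
case=> _ _ [eigs offdiag] _ vecs; split; apply/matrixP => i k.
  have [le_in le_kn] : (i <= n)%N /\ (k <= n)%N by split; rewrite -ltnS.
  rewrite mass_eigvecE mxE [LHS]vecs // /vec /mom moment_leg_coef //.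
  by rewrite [eig _ * _]mulrC mulfK // lt0r_neq0 // durrmeyer_eig_gt0.
rewrite !mxE.
have [<-|ik] := eqVneq i k; last by rewrite offdiag // mulr0n.
have lt_in := ltn_ord i.
by rewrite eigs ?(ltnW lt_in) // mass_eigE.
Qed.

End Correctness.

Theorem mainTheorem4 (R : realType) :
  exists (prog : cmd) (ops : nat -> nat),
    [/\ forall n : nat, exists s : state R,
          [/\ exec prog (init_state R n) (ops n) s,
              array_mx n.+1 s 0 = mass_eigvec_mx R n
            & array_mx n.+1 s 1 = mass_eig_mx R n],
        (fun n : nat => (ops n)%:R : R^o) =O_\oo (fun n : nat => n%:R ^+ 2 : R^o)
      & forall n : nat,
          orthogonal_mx (mass_eigvec_mx R n) /\
          mass_mx R n =
            mass_eigvec_mx R n *m mass_eig_mx R n *m (mass_eigvec_mx R n)^T].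
Proof.
have [ops opsP] := choice (prog_correct R).
exists eigendecomposition_prog, ops; split.
- move=> n; have [s [ex _ /ready_outputs[Qs Ls]]] := opsP n.
  by exists s.
  (* For n > 0 one has n + 1 <= 2 n, and 72 = 18 * 4. *)
- apply/eqO_exP; exists 72%:R; first by rewrite ltr0n.
  near=> n; have n_gt0 : (0 < n)%N by near: n; exact: nbhs_infty_gt.
  have [s [_ ops_le _]] := opsP n.
  rewrite normr_nat normrX normr_nat -natrX -natrM ler_nat.
  by apply: leq_trans ops_le _; rewrite !expnS !expn0; nia.
- move=> n; split; first exact: mass_eigvec_orthogonal.
  exact: mass_mx_eigendecomposition.
Unshelve. all: by end_near.
Qed.
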